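(* Let $n,d\ge 1$ be integers and let $q$ be a prime power with $q\equiv5\pmod 6$ and $\gcd(2d+1,q-1)=1$. Let $$X_d^{2n}=\left\{\sum_{i=0}^n(x_{2i}+x_{2i+1})(x_{2i}^2-x_{2i}x_{2i+1}+x_{2i+1}^2)^d=0\right\}\subset\mathbb P^{2n+1}$$ over $\mathbb F_q$. Then $$|X_d^{2n}(\mathbb F_q)|=|\mathbb P^{2n}(\mathbb F_q)|.$$ *)

(* Defs.v *)
From HB Require Import structures.
From mathcomp Require Import all_boot all_order all_algebra.
From mathcomp Require Import mpoly.

Set Implicit Arguments.
Unset Strict Implicit.
Unset Printing Implicit Defensive.

Import GRing.Theory.
Local Open Scope ring_scope.

Definition proportional (F : finFieldType) (k : nat) : rel 'rV[F]_k :=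
  fun u v => [exists a : F, (a != 0) && (v == a *: u)].

(* The F-rational points of P^m: nonzero vectors of F^(m+1) modulo scaling. *)
Definition proj_space (F : finFieldType) (m : nat) : {set {set 'rV[F]_m.+1}} :=
  equivalence_partition (@proportional F m.+1) [set v : 'rV[F]_m.+1 | v != 0].

(* Meaningful for homogeneous f, for which vanishing at one representative of *)
(* a point is the same as vanishing at all of them.                           *)
Definition proj_zeros (F : finFieldType) (m : nat) (f : {mpoly F[m.+1]}) :
    {set {set 'rV[F]_m.+1}} :=
  [set P in proj_space F m | [forall v in P, f.@[fun i => v 0 i] == 0]].

(* The indices 2i and 2i+1 are at most 2n+1, so inord does not truncate. *)
Definition X_poly (F : finFieldType) (n d : nat) : {mpoly F[(2 * n + 1).+1]} :=
  \sum_(i < n.+1)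
    let x := 'X_(inord (2 * i)) in
    let y := 'X_(inord (2 * i + 1)) in
    (x + y) * (x ^+ 2 - x * y + y ^+ 2) ^+ d.

Definition X_points (F : finFieldType) (n d : nat) :
    {set {set 'rV[F]_(2 * n + 1).+1}} :=
  proj_zeros (X_poly F n d).

Lemma proportional_equiv (F : finFieldType) (k : nat) :
  equivalence_rel (@proportional F k).
Proof.
have sym u v : @proportional F k u v -> proportional v u.
  case/existsP=> a /andP[a0 /eqP->]; apply/existsP; exists a^-1.
  by rewrite invr_eq0 a0 scalerA mulVf // scale1r eqxx.
have tr u v w : @proportional F k u v -> proportional v w -> proportional u w.
  case/existsP=> a /andP[a0 /eqP->] /existsP[b /andP[b0 /eqP->]].
  by apply/existsP; exists (b * a); rewrite mulf_neq0 //= scalerA.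
move=> u v w; split=> [|uv].
  by apply/existsP; exists 1; rewrite oner_neq0 scale1r eqxx.
by apply/idP/idP; [apply: tr; apply: sym | apply: tr].
Qed.

Lemma X_poly_homog (F : finFieldType) (n d : nat) :
  X_poly F n d \is (2 * d + 1).-homog.
Proof.
have hX j : ('X_j : {mpoly F[(2 * n + 1).+1]}) \is 1.-homog.
  by rewrite dhomogX; apply/eqP/mdeg1.
have hM j k : ('X_j * 'X_k : {mpoly F[(2 * n + 1).+1]}) \is 2.-homog.
  exact: (dhomogM (hX j) (hX k)).
apply: rpred_sum => i _; rewrite /= (addnC (2 * d)).
apply: dhomogM; first by rewrite rpredD.
by apply: dhomogMn; rewrite !expr2 rpredD ?rpredB.
Qed.

(* Main.v *)
Require Import Defs.
From mathcomp Require Import all_boot all_order all_algebra finfield.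
From mathcomp Require Import mpoly ring.

Set Implicit Arguments.
Unset Strict Implicit.
Unset Printing Implicit Defensive.

Import GRing.Theory.
Local Open Scope ring_scope.

(** The reason is that every fibre of the binary form
    f(x, y) = (x + y) (x^2 - x y + y^2)^d  on F^2 has exactly q elements, so
    that a sum of values of f at independent pairs takes the value 0 as often
    as a linear form does.

    Write N(x, y) = x^2 - x y + y^2 and s = x + y. Since q = 2 modulo 3, cubing
    is injective on F; as s N(x, y) = x^3 - (- y)^3, the factor N(x, y) can
    vanish only where s does. On the line s = 0 the form f vanishes, and x
    is a coordinate on that line. Off the line, f(x, y) = s^(2d+1) N(u, 1 - u)^d
    with u = x / s and N(u, 1 - u) nonzero; as 2d + 1 is prime to q - 1, the
    value of f and u determine s, hence x and y. Altogether (x, y) is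
    determined by f(x, y) together with the coordinate x or u
    ([pair_form_inj]).

    Hence replacing the first two coordinates of a vector by the value of the
    whole equation and this coordinate is a permutation of F^(2n+2)
    ([straighten_inj]), which carries the affine cone over X to the coordinate
    hyperplane of equation v_0 = 0. Counting the nonzero vectors of both by
    lines through the origin, each of which has q - 1 of them
    ([card_proj_subset]), gives the projective statement. *)

(** * Power maps on a finite field *)

(** A quotient of two nonzero elements with the same m-th power is killed by
    the exponents m and #|F| - 1, hence by their gcd. *)
Lemma expf_coprime_inj (F : finFieldType) (m : nat) :
  (0 < m)%N -> coprime m (#|F| - 1) -> injective (fun x : F => x ^+ m).
Proof.
move=> m0 com x y /= exy.
have [y0|y0] := eqVneq y 0.
  by move/eqP: exy; rewrite y0 expr0n gtn_eqF //= expf_eq0 m0 => /eqP.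
have [x0|x0] := eqVneq x 0.
  move/esym/eqP: exy; rewrite x0 expr0n gtn_eqF //= expf_eq0 m0 /=.
  by rewrite (negPf y0).
have tm : (x / y) ^+ m = 1 by rewrite expr_div_n exy divff // expf_neq0.
have t0 : x / y != 0 by rewrite mulf_neq0 ?invr_eq0.
have tq : (x / y) ^+ (#|F| - 1) = 1.
  apply: (mulfI t0); rewrite -exprS mulr1 subn1 prednK ?expf_card //.
  by apply/card_gt0P; exists 0.
case: (egcdnP (#|F| - 1) m0) => km kn e _.
have t1 : x / y = 1.
  have := congr1 (fun j => (x / y) ^+ j) e.
  rewrite (eqP com) mulnC exprM tm expr1n exprD mulnC exprM tq expr1n mul1r.
  by rewrite expr1 => <-.
by rewrite -[x](divfK y0) t1 mul1r.
Qed.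

(** * The binary form *)

Section PairForm.

Variables (F : finFieldType) (d : nat).

Definition pair_form (x y : F) : F := (x + y) * (x ^+ 2 - x * y + y ^+ 2) ^+ d.

(** A coordinate on each fibre of [pair_form]: the point of the projective line
    through (x, y) off the line x + y = 0, and the position on that line. *)
Definition fibre_coord (x y : F) : F := if x + y == 0 then x else x / (x + y).

Lemma pair_formZ a x y :
  pair_form (a * x) (a * y) = a ^+ (2 * d + 1) * pair_form x y.
Proof.
rewrite /pair_form -mulrDr.
have -> : (a * x) ^+ 2 - a * x * (a * y) + (a * y) ^+ 2 =
          a ^+ 2 * (x ^+ 2 - x * y + y ^+ 2) by ring.
by rewrite exprMn -exprM exprD expr1 mulrACA [a * _]mulrC.
Qed.

Hypothesis coprime3 : coprime 3 (#|F| - 1).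
Hypothesis coprimed : coprime (2 * d + 1) (#|F| - 1).

(** The quadratic factor times x + y is x^3 - (- y)^3, and cubing is
    injective. *)
Lemma pair_form_eq0 x y : (pair_form x y == 0) = (x + y == 0).
Proof.
rewrite /pair_form mulf_eq0 orb_idr // expf_eq0 => /andP[_ /eqP N0].
rewrite addr_eq0; apply/eqP/(expf_coprime_inj _ coprime3) => //=.
apply/eqP; rewrite -subr_eq0; apply/eqP.
transitivity ((x + y) * (x ^+ 2 - x * y + y ^+ 2)); first by ring.
by rewrite N0 mulr0.
Qed.

(** Off the line x + y = 0, the coordinate fixes the direction (u, 1 - u), and
    by homogeneity the value then fixes (x + y)^(2d+1), hence x + y. *)
Lemma pair_form_inj x y x' y' :
  pair_form x y = pair_form x' y' -> fibre_coord x y = fibre_coord x' y' ->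
  x = x' /\ y = y'.
Proof.
move=> ef; have := pair_form_eq0 x y; rewrite ef pair_form_eq0 /fibre_coord.
move=> es; rewrite es; case: ifPn => [s0 xx|s0].
  split=> //; rewrite (eqP s0) eqxx -xx -(eqP s0) in es.
  exact/esym/(addrI x)/eqP.
have s'0 : x' + y' != 0 by rewrite es.
have decomp (a b : F) : a + b != 0 ->
    a = (a + b) * (a / (a + b)) /\ b = (a + b) * (1 - a / (a + b)).
  by move=> ab0; split; field.
have [ex ey] := decomp _ _ s0; have [ex' ey'] := decomp _ _ s'0.
move=> eu; rewrite eu in ex ey; set u := x' / _ in ex ey ex' ey'.
have u0 : pair_form u (1 - u) != 0.
  by rewrite pair_form_eq0 addrC subrK oner_neq0.
have ss : x + y = x' + y'.
  apply: (expf_coprime_inj _ coprimed) => /=; first by rewrite addn1.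
  by apply: (mulIf u0); rewrite -!pair_formZ -ex -ey -ex' -ey'.
by split; [rewrite ex ex' | rewrite ey ey']; rewrite ss.
Qed.

End PairForm.

(** * Counting the affine cone *)

Section Straighten.

Variables (F : finFieldType) (N d : nat) (i j : 'I_N).
Variable (rest : 'rV[F]_N -> F).

(** A triangular change of coordinates: [rest] will depend on the unchanged
    coordinates only, so it is known when the pair at [i], [j] has to be
    recovered from its value and its fibre coordinate. *)
Definition straighten (v : 'rV[F]_N) : 'rV[F]_N :=
  \row_l if l == i then pair_form d (v 0 i) (v 0 j) + rest v
         else if l == j then fibre_coord (v 0 i) (v 0 j) else v 0 l.

Hypothesis ij : i != j.
Hypothesis rest_free : forall v w : 'rV[F]_N,
  (forall l, l != i -> l != j -> v 0 l = w 0 l) -> rest v = rest w.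
Hypothesis coprime3 : coprime 3 (#|F| - 1).
Hypothesis coprimed : coprime (2 * d + 1) (#|F| - 1).

Lemma straighten_inj : injective straighten.
Proof.
move=> v w /rowP e.
have erest l : l != i -> l != j -> v 0 l = w 0 l.
  by move=> li lj; have := e l; rewrite !mxE (negPf li) (negPf lj).
have := e i; rewrite !mxE eqxx (rest_free erest) => /addIr ef.
have := e j; rewrite !mxE eq_sym (negPf ij) eqxx => eu.
have [ei ej] := pair_form_inj coprime3 coprimed ef eu.
apply/rowP => l; have [->//|li] := eqVneq l i.
by have [->//|lj] := eqVneq l j; apply: erest.
Qed.

(** The cone is the preimage of the hyperplane under the bijection
    [straighten]. *)
Lemma card_cone_hyperplane :
  #|[set v : 'rV[F]_N | pair_form d (v 0 i) (v 0 j) + rest v == 0]| =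
  #|[set v : 'rV[F]_N | v 0 i == 0]|.
Proof.
rewrite -[RHS](on_card_preimset (f := straighten)).
  by apply: eq_card => v; rewrite !inE mxE eqxx.
exact: onW_bij (injF_bij straighten_inj).
Qed.

End Straighten.

Lemma card_hyperplane0 (F : finFieldType) (m : nat) :
  #|[set v : 'rV[F]_m.+1 | v 0 0 == 0]| = #|{: 'rV[F]_m}|.
Proof.
pose ext (w : 'rV[F]_m) : 'rV[F]_(1 + m) := row_mx 0 w.
have inj : injective ext by move=> v w /eq_row_mx[].
rewrite -(card_imset predT inj); apply: eq_card => v; rewrite !inE.
apply/eqP/imsetP => [v0|[w _ ->]].
  exists (rsubmx (v : 'rV_(1 + m))) => //.
  have l0 : lsubmx (v : 'rV_(1 + m)) = 0.
    apply/rowP => l; rewrite !mxE (ord1 l) -[RHS]v0.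
    by congr (v _ _); apply: val_inj.
  by rewrite /ext -l0 hsubmxK.
have -> : 0 = @lshift 1 m 0 :> 'I_m.+1 by apply: val_inj.
by rewrite /ext (@row_mxEl _ 1 1 m) mxE.
Qed.

(** * From cones to projective points *)

Lemma card_line (F : finFieldType) (k : nat) (v : 'rV[F]_k) : v != 0 ->
  #|[set w in [set u : 'rV[F]_k | u != 0] | proportional v w]| = (#|F| - 1)%N.
Proof.
move=> v0; have inj : injective (fun a : F => a *: v).
  by move=> a b /= /eqP; rewrite -subr_eq0 -scalerBl scaler_eq0 (negPf v0) orbF
       subr_eq0 => /eqP.
rewrite subn1 -(cardC1 (0 : F)) -(card_imset _ inj); apply: eq_card => w.
rewrite !inE; apply/andP/imsetP => [[_ /existsP[a /andP[a0 /eqP->]]]|[a a0 ->]].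
  by exists a.
have {}a0 : a != 0 by [].
rewrite scaler_eq0 negb_or a0 v0; split=> //.
by apply/existsP; exists a; rewrite a0 /=.
Qed.

(** A cone is a union of lines: the lines it contains partition its nonzero
    vectors. *)
Lemma card_proj_subset (F : finFieldType) (m : nat) (A : {set 'rV[F]_m.+1}) :
    (forall a v, a != 0 -> v \in A -> a *: v \in A) ->
  (#|[set P in proj_space F m | P \subset A]| * (#|F| - 1) = #|A :\ 0%R|)%N.
Proof.
move=> coneA.
have eqv : {in [set v : 'rV[F]_m.+1 | v != 0] & &,
             equivalence_rel (@proportional F m.+1)}.
  by move=> u v w _ _ _; apply: proportional_equiv.
have partE := equivalence_partitionP eqv; rewrite -/(proj_space F m) in partE.
have [/eqP covE trivE n0] := and3P partE.
have line P v : P \in proj_space F m -> v \in P ->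
    v != 0 /\ P = [set w in [set u | u != 0] | proportional v w].
  case/imsetP=> u _ -> /setIdP[v0 uv]; rewrite inE in v0; split=> //.
  apply/setP => w; rewrite !inE; congr (_ && _).
  by have [_ /(_ uv)] := @proportional_equiv F m.+1 u v w.
symmetry; apply: card_uniform_partition => [P|].
  rewrite inE => /andP[Pin _]; have /set0Pn[v vP] : P != set0.
    by apply: contraNneq n0 => <-.
  by have [v0 ->] := line _ _ Pin vP; apply: card_line.
apply/and3P; split; last by rewrite inE (negPf n0).
  apply/eqP/setP => v; rewrite in_setD1; apply/bigcupP/andP.
    case=> P /setIdP[Pin /subsetP PA] vP.
    by have [-> _] := line _ _ Pin vP; rewrite PA.
  case=> v0 vA; have vcov : v \in cover (proj_space F m) by rewrite covE inE.
  have Pin := pblock_mem vcov; have vP : v \in pblock (proj_space F m) v.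
    by rewrite mem_pblock.
  exists (pblock (proj_space F m) v) => //; rewrite inE Pin /=.
  have [_ ->] := line _ _ Pin vP; apply/subsetP => w /setIdP[_].
  by case/existsP=> a /andP[a0 /eqP->]; apply: coneA.
by apply: trivIsetS trivE; apply/subsetP => P /setIdP[].
Qed.

(** * The hypersurface *)

Lemma X_poly_eval (F : finFieldType) (n d : nat)
    (v : 'I_(2 * n + 1).+1 -> F) :
  (X_poly F n d).@[v] =
  \sum_(i < n.+1) pair_form d (v (inord (2 * i))) (v (inord (2 * i + 1))).
Proof.
rewrite /X_poly raddf_sum; apply: eq_bigr => i _ /=.
by rewrite mevalM rmorphXn /= !mevalD mevalN !mevalM !mevalXU.
Qed.

Lemma card_X_cone (F : finFieldType) (n d : nat) :
    coprime 3 (#|F| - 1) -> coprime (2 * d + 1) (#|F| - 1) ->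
  #|[set v : 'rV[F]_(2 * n + 1).+1 | (X_poly F n d).@[v 0] == 0]| =
  #|{: 'rV[F]_(2 * n + 1)}|.
Proof.
move=> co3 cod; rewrite -card_hyperplane0.
(* The terms of the equation other than the one of the pair x_0, x_1. *)
pose rest (v : 'rV[F]_(2 * n + 1).+1) :=
  \sum_(i < n) pair_form d (v 0 (inord (2 * i.+1))) (v 0 (inord (2 * i.+1 + 1))).
have ord0E : (0 : 'I_(2 * n + 1).+1) = inord 0.
  by apply: val_inj; rewrite /= inordK.
have v1 : (inord 1 : 'I_(2 * n + 1).+1) = 1%N :> nat.
  by rewrite inordK // addn1.
have ij : (0 : 'I_(2 * n + 1).+1) != inord 1 by rewrite -val_eqE /= v1.
rewrite -(@card_cone_hyperplane F _ d 0 (inord 1) rest) //.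
  apply: eq_card => v; rewrite !inE X_poly_eval big_ord_recl /= muln0 add0n.
  by rewrite -ord0E.
move=> v w vw; apply: eq_bigr => i _.
have lt1 : (2 * i.+1 + 1 < (2 * n + 1).+1)%N.
  by rewrite ltnS leq_add2r leq_mul2l /=.
have lt0 : (2 * i.+1 < (2 * n + 1).+1)%N by apply: leq_trans lt1; rewrite addn1.
by congr pair_form; apply: vw; rewrite -val_eqE /= ?v1 inordK // ?addn1 mulnS.
Qed.

Theorem proposition5p7 (n d p k q : nat) (F : finFieldType)
    (hn : (1 <= n)%N) (hd : (1 <= d)%N)
    (hp : prime p) (hk : (1 <= k)%N) (hq : q = (p ^ k)%N)
    (hF : #|F| = q)
    (hq6 : q = 5 %[mod 6])
    (hgcd : gcdn (2 * d + 1) (q - 1) = 1%N) :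
  #|X_points F n d| = #|proj_space F (2 * n)|.
Proof.
have q1 : (0 < #|F| - 1)%N by rewrite subn_gt0 finNzRing_gt1.
have cod : coprime (2 * d + 1) (#|F| - 1) by rewrite hF; apply/eqP.
(* q = 5 modulo 6 gives q - 1 = 4 modulo 6, which is prime to 3. *)
have co3 : coprime 3 (#|F| - 1).
  rewrite prime_coprime // hF (divn_eq q 6) hq6 -addnBA //.
  by rewrite dvdn_addr // dvdn_mull.
(* Multiplying by the number q - 1 of nonzero vectors on a line reduces the
   claim to cones. *)
apply/eqP; rewrite -(eqn_pmul2r q1); apply/eqP.
pose A := [set v : 'rV[F]_(2 * n + 1).+1 | (X_poly F n d).@[v 0] == 0].
have coneA (a : F) v : a != 0 -> v \in A -> a *: v \in A.
  rewrite !inE !X_poly_eval => _ /eqP e; apply/eqP.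
  rewrite -[RHS](mulr0 (a ^+ (2 * d + 1))) -[in RHS]e mulr_sumr.
  by apply: eq_bigr => i _; rewrite !mxE pair_formZ.
have -> : X_points F n d = [set P in proj_space F (2 * n + 1) | P \subset A].
  apply/setP => P; rewrite !inE; congr (_ && _).
  by apply/forall_inP/subsetP => h v /h; rewrite inE.
have -> : proj_space F (2 * n) =
          [set P in proj_space F (2 * n) | P \subset [set: 'rV[F]_(2 * n).+1]].
  by apply/setP => P; rewrite inE subsetT andbT.
rewrite !card_proj_subset //; last by move=> *; rewrite inE.
have A0 : 0 \in A.
  rewrite inE X_poly_eval big1 // => i _.
  by rewrite !mxE /pair_form addr0 mul0r.
have := cardsD1 0 A; rewrite A0 card_X_cone // card_mx.
have := cardsD1 0 [set: 'rV[F]_(2 * n).+1]; rewrite inE cardsT card_mx.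
by rewrite (_ : 1 * (2 * n + 1) = 1 * (2 * n).+1)%N ?addn1 // => -> [].
Qed.
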